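(* Let $\Bbbk:\mathbb{T}\times\mathbb{T}\to\mathbb{R}$ be a stable Mercer kernel with $\mu_0<\infty$, let $\mathscr{H}_{\Bbbk}$ be its reproducing kernel Hilbert space, let $\mathrm{u}$ be a bounded input signal, let $\mathscr{T}\subset\mathbb{T}$ be a finite set of measurement times with data $(y_t)_{t\in\mathscr{T}}$ in $\mathbb{R}$, and let $\lambda>0$, $\rho\ge 0$. Then the optimization problem $$\min_{\mathrm{g}\in\mathscr{H}_{\Bbbk}}\ \sum_{t\in\mathscr{T}}\big(\mathrm{L}^{\mathrm{u}}_t(\mathrm{g})-y_t\big)^2+\lambda\|\mathrm{g}\|_{\mathscr{H}_{\Bbbk}}^2\quad\text{s.t.}\quad |\mathcal{F}_\omega(\mathrm{g})|\le\rho\ \ \text{for all }\omega\in\Omega_{\mathbb{T}}$$ is a convex optimization problem with a unique solution $\mathrm{g}^\star$, and $$\|\mathrm{g}^\star\|_{\mathscr{H}_{\Bbbk}}\le\Big(\frac1\lambda\sum_{t\in\mathscr{T}}y_t^2\Big)^{1/2}.$$ The same holds for the equivalent problem in which the constraint is written as $|G(\mathrm{j}\omega)|\le\rho$ for all $\omega\in\Omega_{\mathbb{T}}$, where $G(\mathrm{j}\omega)=\mathcal{F}_\omega(\mathrm{g})$ is the transfer function of the impulse response $\mathrm{g}$.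
   Context: $\mathbb{T}$ denotes either $\mathbb{Z}_+=\{0,1,2,\dots\}$ (discrete time) or $\mathbb{R}_+=[0,\infty)$ (continuous time). $\Omega_{\mathbb{T}}=[0,\pi]$ if $\mathbb{T}=\mathbb{Z}_+$ and $\Omega_{\mathbb{T}}=\mathbb{R}_+$ if $\mathbb{T}=\mathbb{R}_+$. A Mercer kernel is a continuous symmetric positive semidefinite function $\Bbbk:\mathbb{T}\times\mathbb{T}\to\mathbb{R}$; $\mathscr{H}_{\Bbbk}\subseteq\mathbb{R}^{\mathbb{T}}$ is its (real) RKHS, with $\langle \mathrm{g},\Bbbk(t,\cdot)\rangle=g_t$ for $\mathrm{g}=(g_t)_{t\in\mathbb{T}}\in\mathscr{H}_{\Bbbk}$. $\Bbbk$ is stable if $\mathscr{H}_{\Bbbk}\subseteq\ell^1(\mathbb{Z}_+)$ (resp. $L^1(\mathbb{R}_+)$). $\mu_0=\sum_{t\in\mathbb{Z}_+}\Bbbk(t,t)^{1/2}$ if $\mathbb{T}=\mathbb{Z}_+$ and $\mu_0=\int_{\mathbb{R}_+}\Bbbk(t,t)^{1/2}\,dt$ if $\mathbb{T}=\mathbb{R}_+$. The input $\mathrm{u}=(u_t)$ is a bounded signal in $\ell^\infty(\mathbb{Z})$ (resp. $L^\infty(\mathbb{R})$), and $\mathrm{L}^{\mathrm{u}}_t(\mathrm{g})=\sum_{s\in\mathbb{Z}_+}g_su_{t-s}$ (resp. $\int_{\mathbb{R}_+}g_su_{t-s}\,ds$). With $\mathrm{j}$ the imaginary unit, $\mathcal{F}_\omega(\mathrm{g})=\sum_{t\in\mathbb{Z}_+}g_te^{-\mathrm{j}\omega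 t}$ (resp. $\int_{\mathbb{R}_+}g_te^{-\mathrm{j}\omega t}\,dt$). *)

(* Defs.v *)
From HB Require Import structures.
From mathcomp Require Import all_boot all_order all_algebra finmap.
From mathcomp Require Import sesquilinear.
From mathcomp Require Import complex.
From mathcomp Require Import all_classical all_reals all_analysis.

Set Implicit Arguments.
Unset Strict Implicit.
Unset Printing Implicit Defensive.

Import Order.TTheory GRing.Theory Num.Theory.
Import numFieldNormedType.Exports.

Local Open Scope classical_set_scope.
Local Open Scope complex_scope.
Local Open Scope ring_scope.

Definition mercer_kernel (R : realType) (X : topologicalType)
    (k : X -> X -> R) : Prop :=
  [/\ continuous (fun p : X * X => k p.1 p.2 : R),
      forall s t, k s t = k t s
    & forall (n : nat) (x : 'I_n -> X) (a : 'I_n -> R),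
        0 <= \sum_(i < n) \sum_(j < n) a i * a j * k (x i) (x j)].

(* The elements of [rkhs_space] stand for functions [X -> R] through the
   injective linear map [rkhs_eval].  By the Moore-Aronszajn theorem these
   axioms determine the space, its inner product and the evaluation map up to
   a unique isometry, so that quantifying over [H : rkhs k] is speaking of
   the reproducing kernel Hilbert space of [k]. *)
Record rkhs (R : realType) (X : Type) (k : X -> X -> R) := Rkhs {
  rkhs_space :> completeNormedModType R ;
  rkhs_dot : {dot rkhs_space for idfun} ;
  rkhs_normE : forall g : rkhs_space, `|g| ^+ 2 = rkhs_dot g g ;
  rkhs_eval : rkhs_space -> X -> R ;
  rkhs_eval_linear : forall (a : R) (g h : rkhs_space) (t : X),
    rkhs_eval (a *: g + h) t = a * rkhs_eval g t + rkhs_eval h t ;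
  rkhs_eval_inj : injective rkhs_eval ;
  rkhs_reproducing : forall t : X, exists2 kt : rkhs_space,
    rkhs_eval kt = k t & forall g : rkhs_space, rkhs_dot g kt = rkhs_eval g t
}.

Definition complex_exp (R : realType) (z : R[i]) : R[i] :=
  (expR (complex.Re z))%:C * (cos (complex.Im z) +i* sin (complex.Im z)).

Variant time_kind := DiscreteTime | ContinuousTime.

Section time.
Variables (R : realType) (tk : time_kind).

Definition Rplus : set R := [set` `[0, +oo[].

Definition time : topologicalType :=
  match tk with
  | DiscreteTime => nat
  | ContinuousTime => set_type Rplus
  end.

Definition two_sided_time : Type :=
  match tk with DiscreteTime => int | ContinuousTime => R end.

Definition frequencies : set R :=
  match tk with
  | DiscreteTime => [set` `[0, pi]]
  | ContinuousTime => Rplus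
  end.

End time.

Arguments Rplus : clear implicits.
Arguments frequencies : clear implicits.

Section signals.
Variable R : realType.

Definition real_of_time (tk : time_kind) : time R tk -> R :=
  match tk with
  | DiscreteTime => fun t : nat => t%:R
  | ContinuousTime => fun t : set_type (Rplus R) => set_val t
  end.

(* A Borel function on [R] represents its class in $L^\infty(\mathbb{R})$. *)
Definition bounded_input (tk : time_kind) : (two_sided_time R tk -> R) -> Prop :=
  match tk with
  | DiscreteTime => fun u : int -> R => bounded_fun u
  | ContinuousTime => fun u : R -> R => u \in Lfun (@lebesgue_measure R) +oo%E
  end.

(* [u_(t - s)] as a function of [s], for a fixed time [t]. *)
Definition delayed (tk : time_kind) :
    (two_sided_time R tk -> R) -> time R tk -> time R tk -> R :=
  match tk with
  | DiscreteTime => fun (u : int -> R) (t s : nat) => u (t%:Z - s%:Z)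
  | ContinuousTime => fun (u : R -> R) (t s : set_type (Rplus R)) =>
      u (set_val t - set_val s)
  end.

(* In continuous time, ['valL_ 0] extends a function on [Rplus] by zero to the
   whole real line, which does not affect integrals over [Rplus]. *)
Definition absolutely_integrable (tk : time_kind) : (time R tk -> R) -> Prop :=
  match tk with
  | DiscreteTime => fun f : nat -> R =>
      (\sum_(0 <= t <oo) `|f t|%:E < +oo)%E
  | ContinuousTime => fun f : set_type (Rplus R) -> R =>
      lebesgue_measure.-integrable (Rplus R) (EFin \o 'valL_ 0 f)
  end.

Definition time_integral (tk : time_kind) : (time R tk -> R) -> R :=
  match tk with
  | DiscreteTime => fun f : nat -> R => limn (series f)
  | ContinuousTime => fun f : set_type (Rplus R) -> R =>
      \int[lebesgue_measure]_(t in Rplus R) 'valL_ 0 f t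
  end.

Definition time_integralC (tk : time_kind) (f : time R tk -> R[i]) : R[i] :=
  time_integral (fun t => complex.Re (f t)) +i*
  time_integral (fun t => complex.Im (f t)).

Definition mu0 (tk : time_kind) : (time R tk -> time R tk -> R) -> \bar R :=
  match tk with
  | DiscreteTime => fun k : nat -> nat -> R =>
      (\sum_(0 <= t <oo) (Num.sqrt (k t t))%:E)%E
  | ContinuousTime => fun k : set_type (Rplus R) -> set_type (Rplus R) -> R =>
      (\int[lebesgue_measure]_(t in Rplus R)
         ('valL_ 0 (fun s => Num.sqrt (k s s)) t)%:E)%E
  end.

Definition stable (tk : time_kind) (k : time R tk -> time R tk -> R)
    (H : rkhs k) : Prop :=
  forall g : H, absolutely_integrable (rkhs_eval g).

Definition output (tk : time_kind) (u : two_sided_time R tk -> R)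
    (t : time R tk) (g : time R tk -> R) : R :=
  time_integral (fun s => g s * delayed u t s).

Definition fourier (tk : time_kind) (w : R) (g : time R tk -> R) : R[i] :=
  time_integralC (fun t =>
    (g t)%:C * complex_exp (- ('i%C * (w * real_of_time t)%:C))).

(* In discrete time this is the z-transform of [g] evaluated at [exp s], so
   that the imaginary axis is mapped to the unit circle. *)
Definition transfer_function (tk : time_kind) (g : time R tk -> R)
    (s : R[i]) : R[i] :=
  time_integralC (fun t =>
    (g t)%:C * complex_exp (- (s * (real_of_time t)%:C))).

Lemma transfer_function_imaginary_axis (tk : time_kind) (g : time R tk -> R)
    (w : R) : transfer_function g ('i%C * w%:C) = fourier w g.
Proof.
apply: (congr1 (@time_integralC tk)); apply/funext => t.
by congr (_ * complex_exp (- _)); rewrite rmorphM mulrA.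
Qed.

End signals.

(* Minimize [J g] subject to [c w g <= rho] for all [w] in [W]. *)
Section constrained_minimization.
Variables (R : realType) (H : lmodType R) (I : Type).
Variables (J : H -> R) (W : set I) (c : I -> H -> R) (rho : R).

Definition feasible : set H := [set g | forall w, W w -> c w g <= rho].

Definition convex_problem : Prop :=
  [/\ @convex_function R H setT J,
      forall w, W w -> @convex_function R H setT (c w)
    & @convex_set R H feasible].

Definition is_solution (g : H) : Prop :=
  feasible g /\ forall h, feasible h -> J g <= J h.

End constrained_minimization.

(* Main.v *)
Require Import Defs.
From HB Require Import structures.
From mathcomp Require Import all_boot all_order all_algebra finmap.
From mathcomp Require Import sesquilinear.
From mathcomp Require Import complex.
From mathcomp Require Import all_classical all_reals all_analysis.
From mathcomp Require Import measurable_realfun ess_sup_inf.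
From mathcomp Require Import ring lra.

Set Implicit Arguments.
Unset Strict Implicit.
Unset Printing Implicit Defensive.

Import Order.TTheory GRing.Theory Num.Theory.
Import numFieldNormedType.Exports.

Local Open Scope classical_set_scope.
Local Open Scope complex_scope.
Local Open Scope ring_scope.

(** The objective [J] is a sum of squares of affine functionals of [g] plus
[lambda] times the squared norm of a Hilbert space.  Each square is convex, and
the parallelogram law makes the last term strongly convex: at the midpoint of
[g] and [h], [J] lies below the average of its end values by at least
[lambda / 4 * `|g - h| ^+ 2].  In a closed convex feasible set two points whose
values are close to the infimum are therefore close to each other, so that a
minimizing sequence is Cauchy, its limit is a minimizer, and no other minimizer
exists ([strongly_convex_minimizer_exists],
[strongly_convex_minimizer_unique]).  As [g = 0] is feasible, comparing [J g]
with [J 0], the sum of the squared data, gives the bound on the norm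
([regularized_least_squares_well_posed]).

What remains is that the outputs and the Fourier transform depend continuously
on [g].  The reproducing property and the Cauchy-Schwarz inequality give
[`|g t| <= `|g| * Num.sqrt (k t t)] ([rkhs_eval_bound]), so that the integral
of [g] against a test signal bounded by [M] is at most [M * mu0 * `|g|]
([time_integral_bound]).  The output at time [t] is such an integral, against
the delayed input, and so are the real and imaginary parts of the Fourier
transform, against [cos] and [- sin].  The Fourier gain is then a seminorm
dominated by a multiple of the norm, whence the feasible set is closed and
convex.  On the imaginary axis the transfer function is the Fourier transform,
so that both forms of the constraint are the same problem. *)

(** * Inner products and minimization in Hilbert spaces *)

Section inner_product.
Variables (R : realType) (H : normedModType R) (dot : {dot H for idfun}).
Hypothesis normE : forall g : H, `|g| ^+ 2 = dot g g.

Lemma dot_sym g h : dot g h = dot h g.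
Proof. by rewrite (hermC dot g h) /= expr0 mul1r. Qed.

Let dotDl f g h : dot (f + g) h = dot f h + dot g h.
Proof. exact: linearDl. Qed.

Let dotZl (a : R) g h : dot (a *: g) h = a * dot g h.
Proof. exact: linearZl_LR. Qed.

Lemma sqr_norm_comb (a b : R) (g h : H) :
  `|a *: g + b *: h| ^+ 2 =
  a ^+ 2 * `|g| ^+ 2 + 2 * a * b * dot g h + b ^+ 2 * `|h| ^+ 2.
Proof.
rewrite !normE dotDl !dotZl ![dot _ (_ + _)]dot_sym !dotDl !dotZl.
by rewrite (dot_sym h g); ring.
Qed.

(** The defect of convexity of the squared norm is explicit; it is what makes the
regularized objective strongly convex. *)
Lemma sqr_norm_conv (t : R) (g h : H) :
  `|t *: g + (1 - t) *: h| ^+ 2 =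
  t * `|g| ^+ 2 + (1 - t) * `|h| ^+ 2 - t * (1 - t) * `|g - h| ^+ 2.
Proof.
have := sqr_norm_comb 1 (- 1) g h; rewrite scale1r scaleN1r => ->.
by rewrite sqr_norm_comb; ring.
Qed.

(** Cauchy-Schwarz follows from the triangle inequality, which is part of the
normed structure: expand both sides of
[`|g + h| ^+ 2 <= (`|g| + `|h|) ^+ 2]. *)
Lemma dot_le_norm (g h : H) : dot g h <= `|g| * `|h|.
Proof.
have := sqr_norm_comb 1 1 g h; rewrite !scale1r => e.
have : `|g + h| ^+ 2 <= (`|g| + `|h|) ^+ 2.
  by rewrite lerXn2r ?nnegrE ?addr_ge0// ler_normD.
rewrite e; nra.
Qed.

Lemma norm_dot_le (g h : H) : `|dot g h| <= `|g| * `|h|.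
Proof.
rewrite ler_norml dot_le_norm andbT lerNl.
by have := dot_le_norm (- g) h; rewrite linearNl /= normrN.
Qed.

End inner_product.

Lemma lipschitz_bound_continuous (R : realType) (H : normedModType R)
    (f : H -> R) (C : R) :
  (forall g h, `|f g - f h| <= C * `|g - h|) -> continuous f.
Proof.
move=> fC g; apply/cvgrPdist_lt => e e0.
have C0 : 0 < `|C| + 1 by rewrite ltr_pwDr.
near=> h.
rewrite (le_lt_trans (fC g h))// (@le_lt_trans _ _ ((`|C| + 1) * `|g - h|))//.
  by rewrite ler_wpM2r// (le_trans (ler_norm C))// lerDl.
rewrite mulrC -ltr_pdivlMr//; near: h.
by apply: (@cvgr_dist_lt _ _ _ (nbhs g) _ id g) => //; rewrite divr_gt0.
Unshelve. all: by end_near. Qed.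

Section strongly_convex_minimization.
Variables (R : realType) (H : completeNormedModType R).
Variables (F : set H) (J : H -> R) (c : R).
Hypotheses (c0 : 0 < c) (F0 : F !=set0) (clF : closed F).
(* [1 - 2^-1] is kept so that midpoints are instances of [t] and [1 - t]. *)
Hypothesis midF : forall g h, F g -> F h -> F (2^-1 *: g + (1 - 2^-1) *: h).
Hypotheses (cJ : continuous J) (J0 : forall g, 0 <= J g).
Hypothesis midJ : forall g h, J (2^-1 *: g + (1 - 2^-1) *: h) <=
  2^-1 * J g + (1 - 2^-1) * J h - c * `|g - h| ^+ 2.

Let m := inf (J @` F).

Let m_le g : F g -> m <= J g.
Proof.
move=> Fg; apply: ge_inf; last by exists g.
by exists 0 => _ [h _ <-].
Qed.

(** Near-minimizers are close to each other, since the value at their midpoint is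
no less than [m]. *)
Let gap g h : F g -> F h -> c * `|g - h| ^+ 2 <= 2^-1 * J g + 2^-1 * J h - m.
Proof.
move=> Fg Fh; have := m_le (midF Fg Fh); have := midJ g h.
have -> : 1 - 2^-1 = 2^-1 :> R by field.
lra.
Qed.

Lemma strongly_convex_minimizer_unique g h :
  F g -> (forall f, F f -> J g <= J f) ->
  F h -> (forall f, F f -> J h <= J f) -> g = h.
Proof.
move=> Fg mg Fh mh.
have Jm f : F f -> (forall f', F f' -> J f <= J f') -> J f <= m.
  move=> Ff mf; apply: lb_le_inf; first by exists (J f), f.
  by move=> _ [f' Ff' <-]; exact: mf.
have := gap Fg Fh; have := Jm _ Fg mg; have := Jm _ Fh mh.
move=> h1 h2 h3; apply/eqP; rewrite -subr_eq0 -normr_eq0 -sqrf_eq0.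
by apply/eqP/le_anti; rewrite sqr_ge0 andbT -(pmulr_rle0 _ c0); lra.
Qed.

(** By [gap], a minimizing sequence is Cauchy. *)
Lemma strongly_convex_minimizer_exists :
  exists2 g, F g & forall f, F f -> J g <= J f.
Proof.
have infJ : has_inf (J @` F).
  split; first by case: F0 => g Fg; exists (J g), g.
  by exists 0 => _ [h _ <-].
have /choice[u uP] : forall n : nat, exists g, F g /\ J g < m + n.+1%:R^-1.
  move=> n; have [|_ [g Fg <-] Jg] := @inf_adherent _ _ n.+1%:R^-1 _ infJ.
    by rewrite invr_gt0.
  by exists g.
have cvg_inv : (n.+1%:R^-1 : R) @[n --> \oo] --> 0 by exact: cvg_harmonic.
have : cauchy (u @ \oo).
  apply: (@cauchy_exP R H (u @ \oo)) => e /= e0.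
  have ce : 0 < c * e ^+ 2 by rewrite mulr_gt0// exprn_gt0.
  have [N _ NP] : \forall n \near \oo, (n.+1%:R^-1 : R) < c * e ^+ 2.
    have /cvgrPdist_lt/(_ _ ce) := cvg_inv.
    by apply: filterS => n; rewrite sub0r normrN ger0_norm.
  (* the excesses of [J (u N)] and [J (u n)] over [m] are below [c * e ^+ 2],
     hence so is their mean *)
  exists (u N); exists N => // n /= Nn; rewrite -ball_normE /=.
  rewrite -(@ltr_pXn2r _ 2) ?nnegrE ?(ltW e0)//.
  rewrite -(ltr_pM2l c0) (le_lt_trans (gap (uP N).1 (uP n).1))//.
  have := NP N (leqnn N); have := NP n Nn; have := (uP N).2; have := (uP n).2.
  by move: (n.+1%:R^-1) (N.+1%:R^-1) => /= a b; lra.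
move=> /cauchy_cvg/cvg_ex[g ug]; exists g.
  by apply: (closed_cvg _ clF _ _ ug); apply: nearW => n; exact: (uP n).1.
move=> f Ff; apply: le_trans (m_le Ff).
have Jg : J (u n) @[n --> \oo] --> J g by apply: cvg_comp ug _; exact: cJ.
have mg : m + n.+1%:R^-1 @[n --> \oo] --> m.
  by rewrite -[X in _ --> X]addr0; apply: cvgD => //; exact: cvg_cst.
rewrite -(cvg_lim _ Jg)// -(cvg_lim _ mg)//.
apply: ler_lim; [exact: cvgP Jg|exact: cvgP mg|].
by apply: nearW => n; exact/ltW/(uP n).2.
Qed.

End strongly_convex_minimization.

(** * Regularized least squares under seminorm constraints *)

Section regularized_least_squares.
Variables (R : realType) (H : completeNormedModType R).
Variable dot : {dot H for idfun}.
Hypothesis normE : forall g : H, `|g| ^+ 2 = dot g g.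
Variables (I : finType) (L : I -> H -> R) (B : I -> R) (y : I -> R).
Hypothesis L_lin : forall i a g h, L i (a *: g + h) = a * L i g + L i h.
Hypothesis L_bnd : forall i g, `|L i g| <= B i * `|g|.
Variables (T : Type) (W : set T) (p : T -> H -> R) (C : R).
Hypothesis pD : forall w g h, p w (g + h) <= p w g + p w h.
Hypothesis pZ : forall w a g, p w (a *: g) = `|a| * p w g.
Hypothesis p_bnd : forall w g, p w g <= C * `|g|.
Variables (lambda rho : R).
Hypotheses (lambda0 : 0 < lambda) (rho0 : 0 <= rho).

Let J (g : H) : R := \sum_(i : I) (L i g - y i) ^+ 2 + lambda * `|g| ^+ 2.

Let LB i g h : L i (g - h) = L i g - L i h.
Proof. by rewrite addrC -scaleN1r L_lin; ring. Qed.

Let L0 i : L i 0 = 0.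
Proof. by rewrite -(subrr 0) LB subrr. Qed.

Let LC i (t : R) g h : L i (t *: g + (1 - t) *: h) = t * L i g + (1 - t) * L i h.
Proof. by rewrite L_lin -[_ *: h]addr0 L_lin L0 addr0. Qed.

Let pN w g : p w (- g) = p w g.
Proof. by rewrite -scaleN1r pZ normrN normr1 mul1r. Qed.

Let p0 w : p w 0 = 0.
Proof. by rewrite -(scale0r 0) pZ normr0 mul0r. Qed.

Lemma least_squares_strongly_convex (t : R) g h : 0 <= t -> t <= 1 ->
  J (t *: g + (1 - t) *: h) <=
  t * J g + (1 - t) * J h - lambda * (t * (1 - t)) * `|g - h| ^+ 2.
Proof.
move=> t0 t1; rewrite /J (sqr_norm_conv normE).
have : \sum_i (L i (t *: g + (1 - t) *: h) - y i) ^+ 2 <=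
    t * \sum_i (L i g - y i) ^+ 2 + (1 - t) * \sum_i (L i h - y i) ^+ 2.
  rewrite !mulr_sumr -big_split /=; apply: ler_sum => i _.
  rewrite LC -subr_ge0; set a := L i g; set b := L i h.
  (* the variance identity behind the convexity of a square *)
  have -> : t * (a - y i) ^+ 2 + (1 - t) * (b - y i) ^+ 2 -
      (t * a + (1 - t) * b - y i) ^+ 2 = t * (1 - t) * (a - b) ^+ 2 by ring.
  by rewrite mulr_ge0 ?sqr_ge0// mulr_ge0// subr_ge0.
move: (\sum_i _) (\sum_i _) (\sum_i _) => a b c abc.
rewrite -subr_ge0 in abc; rewrite -subr_ge0.
by apply: le_trans abc _; rewrite le_eqVlt; apply/orP; left; apply/eqP; ring.
Qed.

Let J_ge0 g : 0 <= J g.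
Proof.
by rewrite addr_ge0 ?sumr_ge0// ?mulr_ge0 ?sqr_ge0 ?(ltW lambda0)// => i _;
  rewrite sqr_ge0.
Qed.

Lemma least_squares_continuous : continuous J.
Proof.
move=> g; apply: cvgD.
  apply: cvg_big => [x|i _]; first exact: add_continuous.
  apply: cvgM; apply: cvgB; try exact: cvg_cst.
    by apply: (@lipschitz_bound_continuous _ _ _ (B i)) => ? ?; rewrite -LB.
  by apply: (@lipschitz_bound_continuous _ _ _ (B i)) => ? ?; rewrite -LB.
by apply: cvgM; [exact: cvg_cst|apply: cvgM; apply: cvg_norm; exact: cvg_id].
Qed.

Lemma seminorm_lipschitz w g h : `|p w g - p w h| <= C * `|g - h|.
Proof.
apply: le_trans (p_bnd w _); rewrite ler_norml; apply/andP; split.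
  have := pD w (h - g) g; rewrite subrK -(opprB g h) pN; lra.
have := pD w (g - h) h; rewrite subrK; lra.
Qed.

Lemma seminorm_convex w (t : R) g h : 0 <= t -> t <= 1 ->
  p w (t *: g + (1 - t) *: h) <= t * p w g + (1 - t) * p w h.
Proof.
move=> t0 t1; apply: le_trans (pD _ _ _) _.
by rewrite !pZ !ger0_norm// subr_ge0.
Qed.

Lemma feasible_closed : closed (feasible W p rho).
Proof.
rewrite (_ : feasible W p rho =
    \bigcap_(w in W) (p w @^-1` [set x | x <= rho])); last first.
  by apply/seteqP; split.
apply: closed_bigI => w _; apply: closed_comp; last exact: closed_le.
by move=> g _; apply: (lipschitz_bound_continuous (seminorm_lipschitz w)).
Qed.

Lemma feasible_conv (t : R) g h : 0 <= t -> t <= 1 ->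
  feasible W p rho g -> feasible W p rho h ->
  feasible W p rho (t *: g + (1 - t) *: h).
Proof.
move=> t0 t1 Fg Fh w Ww; apply: le_trans (seminorm_convex _ _ _ t0 t1) _.
have := Fg w Ww; have := Fh w Ww; nra.
Qed.

Lemma feasible0 : feasible W p rho 0.
Proof. by move=> w _; rewrite p0. Qed.

(** Boundedness of the measurements [L i] and of the seminorms [p w] makes them
continuous: the feasible set is then closed, and [J] passes to the limit along
a minimizing sequence. *)
Theorem regularized_least_squares_well_posed :
  convex_problem J W p rho /\
  exists g : H, [/\ is_solution J W p rho g,
    forall h : H, is_solution J W p rho h -> h = g
    & `|g| <= Num.sqrt (lambda^-1 * \sum_i y i ^+ 2)].
Proof.
have half01 : 0 <= 2^-1 :> R /\ 2^-1 <= 1 :> R by split; lra.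
split.
  split=> [t g h _ _|w _ t g h _ _|g h t].
  - apply: le_trans (least_squares_strongly_convex g h _ _) _ => //.
    rewrite gerBl; apply: mulr_ge0; last exact: sqr_ge0.
    by apply: mulr_ge0; [exact: ltW|rewrite mulr_ge0// subr_ge0].
  - exact: seminorm_convex.
  - by rewrite !inE => Fg Fh; exact: feasible_conv.
have c0 : 0 < lambda * (2^-1 * (1 - 2^-1)) by rewrite mulr_gt0//; lra.
have midF g h : feasible W p rho g -> feasible W p rho h ->
    feasible W p rho (2^-1 *: g + (1 - 2^-1) *: h).
  by apply: feasible_conv; case: half01.
have midJ g h : J (2^-1 *: g + (1 - 2^-1) *: h) <= 2^-1 * J g +
    (1 - 2^-1) * J h - lambda * (2^-1 * (1 - 2^-1)) * `|g - h| ^+ 2.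
  by apply: least_squares_strongly_convex; case: half01.
have F0 : feasible W p rho !=set0 by exists 0; exact: feasible0.
have [g Fg mg] := strongly_convex_minimizer_exists c0 F0 feasible_closed midF
  least_squares_continuous J_ge0 midJ.
exists g; split => // [h [Fh mh]|].
  exact: (strongly_convex_minimizer_unique c0 midF J_ge0 midJ).
have Sy0 : 0 <= \sum_i y i ^+ 2 by apply: sumr_ge0 => i _; exact: sqr_ge0.
rewrite -[leLHS]ger0_norm// -sqrtr_sqr ler_wsqrtr// ler_pdivlMl//.
have : J g <= \sum_i y i ^+ 2.
  apply: le_trans (mg _ feasible0) _.
  rewrite /J normr0 expr0n mulr0 addr0; apply: ler_sum => i _.
  by rewrite L0 sub0r sqrrN.
apply: le_trans; rewrite /J lerDr; apply: sumr_ge0 => i _; exact: sqr_ge0.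
Qed.

End regularized_least_squares.

(** * Integrals of a signal against a bounded test signal *)

Section reflection.
Variable R : realType.
Local Notation mu := (@lebesgue_measure R).

Lemma measurable_reflection (a : R) :
  measurable_fun [set: R] (fun s : R => a - s).
Proof.
by apply: measurable_funB => //; exact: measurable_cst.
Qed.

(** A Borel measure is determined by its values on the intervals [`]x, y]], and
reflection sends these to intervals of the same length. *)
Lemma lebesgue_measure_reflection (a : R) (A : set R) : measurable A ->
  mu ((fun s : R => a - s) @^-1` A) = mu A.
Proof.
move=> mA.
pose phi : measurableTypeR R -> measurableTypeR R := fun s => a - s.
have mphi : measurable_fun setT phi by exact: measurable_reflection.
pose phi_mixin := isMeasurableFun.Build _ _ _ _ phi mphi.
pose F : {mfun measurableTypeR R >-> measurableTypeR R} := HB.pack phi phi_mixin.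
apply/esym; rewrite (@lebesgue_measure_unique R (pushforward mu F))//.
move=> _ [[x y]] _ <-; rewrite /pushforward.
rewrite [X in _ = mu X](_ : _ = `[a - y, a - x[%classic); last first.
  by apply/seteqP; split => r /=; rewrite /F /= /phi !in_itv/= => /andP[? ?];
    apply/andP; split; lra.
rewrite !lebesgue_measure_itv/= !lte_fin ltrD2l ltrN2.
by congr (if _ then _ else _); rewrite -!EFinB; congr EFin; ring.
Qed.

(** This transports the almost everywhere bound of the input to the delayed input,
which is read backwards in time. *)
Lemma ae_reflection (a : R) (P : set R) :
  {ae mu, forall x, P x} -> {ae mu, forall s, P (a - s)}.
Proof.
move=> [N [mN N0 PN]]; exists ((fun s : R => a - s) @^-1` N); split.
- by rewrite -[_ @^-1` _]setTI; exact: measurable_reflection.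
- by rewrite lebesgue_measure_reflection.
- by move=> s /= nP; apply: PN.
Qed.

End reflection.

Section extension_by_zero.
Variables (R : realType) (A : set R).

Lemma valLM (f g : A -> R) (r : R) :
  'valL_ 0 (fun t => f t * g t) r = 'valL_ 0 f r * 'valL_ 0 g r.
Proof. by rewrite /=; case: ('oinv_set_val r) => //=; rewrite mulr0. Qed.

Lemma valLD (f g : A -> R) (r : R) :
  'valL_ 0 (fun t => f t + g t) r = 'valL_ 0 f r + 'valL_ 0 g r.
Proof. by rewrite /=; case: ('oinv_set_val r) => //=; rewrite addr0. Qed.

Lemma valLZ (a : R) (f : A -> R) (r : R) :
  'valL_ 0 (fun t => a * f t) r = a * 'valL_ 0 f r.
Proof. by rewrite /=; case: ('oinv_set_val r) => //=; rewrite mulr0. Qed.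

Lemma valL_norm_le (f g : A -> R) : (forall t, `|f t| <= g t) ->
  forall r, `|'valL_ 0 f r| <= 'valL_ 0 g r.
Proof. by move=> fg r /=; case: ('oinv_set_val r) => //=; rewrite normr0. Qed.

Lemma valL_restriction (f : R -> R) (r : R) :
  A r -> 'valL_ 0 (fun t : A => f (set_val t)) r = f r.
Proof.
move=> Ar; have := congr1 (fun F => F f r) (sigLK (0 : R) (A := A)).
by rewrite /= /restrict /patch mem_set.
Qed.

End extension_by_zero.

Section test_signals.
Variable R : realType.

(** In continuous time measurability is included, so that the product with an
integrable signal is integrable.  In discrete time there are no null sets to
neglect. *)
Definition essentially_bounded (tk : time_kind) : (time R tk -> R) -> R -> Prop :=
  match tk with
  | DiscreteTime => fun (f : nat -> R) M => forall t, `|f t| <= M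
  | ContinuousTime => fun (f : set_type (Rplus R) -> R) M =>
      @measurable_fun _ _ (measurableTypeR R) R (Rplus R) ('valL_ 0 f) /\
      {ae lebesgue_measure, forall r, Rplus R r -> `|'valL_ 0 f r| <= M}
  end.

(** At [fun t => Num.sqrt (k t t)] this is [mu0 k]. *)
Definition total_mass (tk : time_kind) : (time R tk -> R) -> \bar R :=
  match tk with
  | DiscreteTime => fun f : nat -> R => (\sum_(0 <= t <oo) (f t)%:E)%E
  | ContinuousTime => fun f : set_type (Rplus R) -> R =>
      (\int[lebesgue_measure]_(t in Rplus R) ('valL_ 0 f t)%:E)%E
  end.

Lemma measurable_Rplus : @measurable _ (measurableTypeR R) (Rplus R).
Proof. exact: measurable_itv. Qed.
#[local] Hint Resolve measurable_Rplus : core.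

Lemma integrable_valLM (f phi : set_type (Rplus R) -> R) (M : R) :
  @absolutely_integrable R ContinuousTime f ->
  @essentially_bounded ContinuousTime phi M ->
  @absolutely_integrable R ContinuousTime (fun t => f t * phi t).
Proof.
move=> /= fi [mphi phiM]; have /measurable_int/measurable_EFinP mf := fi.
have mfphi : @measurable_fun _ _ (measurableTypeR R) R (Rplus R)
    ('valL_ 0 (fun t => f t * phi t)).
  rewrite (_ : 'valL_ 0 _ = 'valL_ 0 f \* 'valL_ 0 phi); last first.
    by apply/funext => r; exact: valLM.
  exact: measurable_funM.
apply/integrableP; split; first exact/measurable_EFinP.
have /integrableP[_ Mf] := integrableZl measurable_Rplus M fi.
apply: le_lt_trans Mf; apply: ae_ge0_le_integral => //.
- by apply: measurableT_comp => //; exact/measurable_EFinP.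
- apply: measurableT_comp => //; apply: measurable_funeM.
  exact/measurable_EFinP.
- move: phiM; apply: (@filterS _ _ (ae_filter_ringOfSetsType _)) => r phir Dr.
  have {}phir := phir Dr.
  change ((`|'valL_ 0 (fun t => f t * phi t) r|)%:E <=
    (`|M * 'valL_ 0 f r|)%:E)%E.
  rewrite lee_fin valLM !normrM mulrC.
  by rewrite ler_wpM2r// (le_trans phir)// ler_norm.
Qed.

Lemma absolutely_summableM (f phi : nat -> R) (M : R) :
  @absolutely_integrable R DiscreteTime f ->
  @essentially_bounded DiscreteTime phi M ->
  cvgn (series (fun t => f t * phi t)).
Proof.
move=> /= fi phiM; apply: normed_cvg.
have fs : cvgn (series (fun t => `|f t|)) by exact: nnseries_is_cvg.
have Mfs := is_cvg_seriesZ (k := M) fs.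
apply: series_le_cvg Mfs => n.
- exact: normr_ge0.
- apply: mulr_ge0 => //; exact: le_trans (phiM 0%N).
- by rewrite /= normrM mulrC ler_wpM2r.
Qed.

Lemma time_integral_linear (tk : time_kind) (f g phi : time R tk -> R)
    (a M : R) :
  absolutely_integrable f -> absolutely_integrable g ->
  essentially_bounded phi M ->
  time_integral (fun t => (a * f t + g t) * phi t) =
  a * time_integral (fun t => f t * phi t) +
  time_integral (fun t => g t * phi t).
Proof.
case: tk f g phi => f g phi fi gi phiM.
  have fs := absolutely_summableM fi phiM.
  have gs := absolutely_summableM gi phiM.
  rewrite /= -[a * _]/(a *: _) -lim_seriesZ// -lim_seriesD//; last first.
    exact: is_cvg_seriesZ.
  congr (limn (series _)); apply/funext => t.
  by rewrite mulrDl -mulrA.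
have fs := integrable_valLM fi phiM; have gs := integrable_valLM gi phiM.
rewrite /time_integral -RintegralZl// -RintegralD//; last first.
  by apply: eq_integrable (integrableZl _ a fs) => // r _.
apply: eq_Rintegral => r _.
by rewrite -valLZ -valLD; congr ('valL_ 0 _ r); apply/funext => t;
  rewrite mulrDl mulrA.
Qed.

Lemma measurable_valL (f : set_type (Rplus R) -> R) :
  continuous f ->
  @measurable_fun _ _ (measurableTypeR R) R (Rplus R) ('valL_ 0 f).
Proof.
move=> /(@subspace_valL_continuousP' _ _ R 0 f).
exact: (@subspace_continuous_measurable_fun R _ ('valL_ 0 f) measurable_Rplus).
Qed.

(** The factor [B] is the total mass of [K]; it depends neither on the signal [f]
nor on the test signal [phi], which is what makes all functionals obtained from
the same envelope [K] bounded.  In continuous time the continuity of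
[K] is what makes it measurable. *)
Lemma time_integral_bound (tk : time_kind) (K : time R tk -> R) :
  continuous K -> (forall t, 0 <= K t) -> (total_mass K < +oo)%E ->
  exists B : R, forall (f phi : time R tk -> R) (M c : R),
    absolutely_integrable f -> essentially_bounded phi M -> 0 <= M -> 0 <= c ->
    (forall t, `|f t| <= c * K t) ->
    `|time_integral (fun t => f t * phi t)| <= M * B * c.
Proof.
case: tk K => K cK K0 massK.
  exists (limn (series K)) => f phi M c _ phiM M0 c0 fK.
  have Ks : cvgn (series K) by exact: nnseries_is_cvg.
  have le_fphi n : `|f n * phi n| <= ((M * c) *: K) n.
    by rewrite normrM mulrC -[leRHS]/(M * c * K n) -mulrA ler_pM.
  have cKs : cvgn (series ((M * c) *: K)) by exact: is_cvg_seriesZ.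
  have cs : cvgn [normed series (fun t => f t * phi t)].
    apply: (series_le_cvg _ _ le_fphi cKs) => n //.
    by rewrite -[leRHS]/(M * c * K n) mulr_ge0// mulr_ge0.
  have massE : limn (series ((M * c) *: K)) = M * c * limn (series K).
    exact: lim_seriesZ.
  rewrite mulrAC -massE.
  by apply: le_trans (lim_series_norm cs) _; exact: lim_series_le.
exists (fine (total_mass K)) => f phi M c fi phiM M0 c0 fK.
have mK : @measurable_fun _ _ (measurableTypeR R) R (Rplus R) ('valL_ 0 K).
  exact: measurable_valL.
have K0' r : 0 <= 'valL_ 0 K r by rewrite /=; case: ('oinv_set_val r).
have fphi := integrable_valLM fi phiM.
apply: le_trans (le_normr_Rintegral measurable_Rplus fphi) _.
have le_mass : (\int[lebesgue_measure]_(t in Rplus R)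
    (`|'valL_ 0 (fun t => f t * phi t) t|)%:E <= (M * c)%:E * total_mass K)%E.
  rewrite /total_mass -ge0_integralZl_EFin//; last 3 first.
  - by move=> r _; rewrite lee_fin.
  - exact/measurable_EFinP.
  - by rewrite mulr_ge0.
  apply: ae_ge0_le_integral => //.
  - apply/measurable_EFinP; apply: measurableT_comp => //.
    by have /measurable_int/measurable_EFinP := fphi.
  - by move=> r _; rewrite -EFinM lee_fin mulr_ge0// mulr_ge0.
  - by apply: measurable_funeM; exact/measurable_EFinP.
  - case: phiM => _.
    apply: (@filterS _ _ (ae_filter_ringOfSetsType _)) => r phir Dr.
    have {}phir := phir Dr.
    rewrite -EFinM lee_fin valLM normrM mulrC -mulrA ler_pM//.
    by rewrite -valLZ; exact: valL_norm_le.
have massK0 : (0 <= total_mass K)%E.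
  by apply: integral_ge0 => r _; rewrite lee_fin.
have massKfin : total_mass K \is a fin_num by rewrite ge0_fin_numE.
rewrite mulrAC -lee_fin EFinM (fineK massKfin); apply: (le_trans _ le_mass).
rewrite /Rintegral fineK// ge0_fin_numE; last exact: integral_ge0.
apply: le_lt_trans le_mass _.
by rewrite -(fineK massKfin) -EFinM ltry.
Qed.

End test_signals.

(** * Delayed inputs and the Fourier transform *)

Section complex_modulus.
Variable R : realType.

Lemma normc_real (a : R) : ComplexField.Normc.normc a%:C = `|a|.
Proof. by rewrite /= expr0n addr0 sqrtr_sqr. Qed.

Lemma normc_le_sum (a b : R) :
  ComplexField.Normc.normc (a +i* b) <= `|a| + `|b|.
Proof.
rewrite /= -[leRHS]ger0_norm ?addr_ge0// -sqrtr_sqr ler_wsqrtr//.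
rewrite sqrrD !real_normK ?num_real// lerD2r lerDl.
by rewrite mulrn_wge0// mulr_ge0.
Qed.

End complex_modulus.

Section system_signals.
Variables (R : realType) (tk : time_kind).

(** In continuous time the bound is the essential supremum of the input, which is
not changed by translation and reflection. *)
Lemma delayed_essentially_bounded (u : two_sided_time R tk -> R)
    (t : time R tk) : bounded_input u ->
  exists2 M : R, 0 <= M & essentially_bounded (delayed u t) M.
Proof.
case: tk u t => u t.
  move=> [M [_ uM]]; exists (`|M| + 1); first by rewrite addr_ge0.
  by move=> s; apply: (uM (`|M| + 1)) => //; rewrite ltr_pwDr// ler_norm.
move=> /[dup] /sub_Lfun_mfun + /sub_Lfun_finLfun; rewrite !inE /= => mu_.
(* the norm at infinity is defined as the essential supremum only when the
   whole space has positive measure, and as 0 otherwise *)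
have mu_pos : (0 < @lebesgue_measure R setT)%E.
  rewrite -set_itvNyy lebesgue_measure_itv/=.
  by apply: adde_gt0; exact: ltry.
rewrite /finite_norm unlock mu_pos; set E := ess_sup _ _ => Efin.
have uE : {ae (@lebesgue_measure R), forall x, (`|u x|%:E <= E)%E}.
  exact: ess_sup_ge.
exists `|fine E|; first exact: normr_ge0.
have dE : {in Rplus R, (fun r => u (set_val t - r)) =1
    'valL_ 0 (fun s : set_type (Rplus R) => u (set_val t - set_val s))}.
  move=> r /set_mem Rr; apply/esym.
  exact: (@valL_restriction R (Rplus R) (fun r => u (set_val t - r))).
split.
  apply: eq_measurable_fun dE _.
  apply: (@measurable_funS _ _ (measurableTypeR R) R setT) => //.
  exact: (measurableT_comp mu_ (measurable_reflection _)).
move: (ae_reflection (set_val t) uE).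
apply: (@filterS _ _ (ae_filter_ringOfSetsType _)) => r uEr Rr.
have /= <- := dE r (mem_set Rr); case: E Efin uEr {uE} => [e _|//|//] /=.
by rewrite lee_fin => /le_trans; apply; exact: ler_norm.
Qed.

Lemma frequency_signal_bounded (w : R) (psi : R -> R) :
  continuous psi -> (forall x, `|psi x| <= 1) ->
  essentially_bounded (fun t : time R tk => psi (w * real_of_time t)) 1.
Proof.
case: tk => cpsi psi1; first by move=> t; exact: psi1.
have valE : {in Rplus R, (fun r => psi (w * r)) =1
    'valL_ 0 (fun t : set_type (Rplus R) => psi (w * set_val t))}.
  move=> r /set_mem Rr; apply/esym.
  exact: (@valL_restriction R (Rplus R) (fun r => psi (w * r))).
split.
  apply: eq_measurable_fun valE _.
  apply: (@measurable_funS _ _ (measurableTypeR R) R setT) => //.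
  apply: continuous_measurable_fun => r.
  apply: continuous_comp; last exact: cpsi.
  by apply: cvgM; [exact: cvg_cst|exact: cvg_id].
apply: aeW => r Rr; rewrite -valE ?inE//; exact: psi1.
Qed.

Lemma fourierE (w : R) (f : time R tk -> R) : fourier w f =
  time_integral (fun t => f t * cos (w * real_of_time t)) +i*
  time_integral (fun t => f t * - sin (w * real_of_time t)).
Proof.
rewrite /fourier /time_integralC; congr (_ +i* _); congr time_integral;
  apply/funext => t; rewrite /complex_exp /=; simpc => /=;
  by rewrite ?oppr0 ?expR0 ?cosN ?sinN; ring.
Qed.

End system_signals.

(** * Bounded functionals on the reproducing kernel Hilbert space *)

Section rkhs_functionals.
Variables (R : realType) (X : topologicalType) (k : X -> X -> R) (H : rkhs k).

(** The representer of the evaluation at [t] is [k t], whose squared norm is its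
own value at [t]. *)
Lemma rkhs_eval_bound (g : H) (t : X) :
  `|rkhs_eval g t| <= `|g| * Num.sqrt (k t t).
Proof.
have [kt ktE ktP] := rkhs_reproducing H t.
rewrite -(ktP g); apply: le_trans (norm_dot_le (@rkhs_normE _ _ _ H) _ _) _.
by rewrite -[ `|kt| ]ger0_norm// -sqrtr_sqr rkhs_normE ktP ktE.
Qed.

Lemma continuous_sqrt_diagonal : mercer_kernel k ->
  continuous (fun t => Num.sqrt (k t t)).
Proof.
move=> [kcont _ _] t; apply: continuous_comp; last exact: sqrt_continuous.
apply: (@continuous_comp _ _ _ (fun t => (t, t)) (fun p => k p.1 p.2)).
  by apply: cvg_pair => /=; exact: cvg_id.
exact: kcont.
Qed.

End rkhs_functionals.

Section time_functionals.
Variables (R : realType) (tk : time_kind) (k : time R tk -> time R tk -> R).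
Variable H : rkhs k.
Hypotheses (k_mercer : mercer_kernel k) (H_stable : stable H).
Hypothesis mu0_fin : (mu0 k < +oo)%E.

Lemma rkhs_functional_linear (phi : time R tk -> R) (M a : R) (g h : H) :
  essentially_bounded phi M ->
  time_integral (fun t => rkhs_eval (a *: g + h) t * phi t) =
  a * time_integral (fun t => rkhs_eval g t * phi t) +
  time_integral (fun t => rkhs_eval h t * phi t).
Proof.
move=> phiM; rewrite -(time_integral_linear _ (H_stable g) (H_stable h) phiM).
by congr time_integral; apply/funext => t; rewrite rkhs_eval_linear.
Qed.

(** The unit ball has the envelope [Num.sqrt (k t t)], whose integral is [mu0]. *)
Lemma rkhs_functional_bounded : exists B : R,
  forall (phi : time R tk -> R) (M : R) (g : H),
  essentially_bounded phi M -> 0 <= M ->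
  `|time_integral (fun t => rkhs_eval g t * phi t)| <= M * B * `|g|.
Proof.
have K0 t : 0 <= Num.sqrt (k t t) by exact: sqrtr_ge0.
have massK : (total_mass (fun t => Num.sqrt (k t t)) < +oo)%E.
  by move: mu0_fin; case: tk k.
have [B BP] :=
  time_integral_bound (continuous_sqrt_diagonal k_mercer) K0 massK.
exists B => phi M g phiM M0; apply: BP => // t.
exact: rkhs_eval_bound.
Qed.

Let gain (w : R) (g : H) : R :=
  ComplexField.Normc.normc (fourier w (rkhs_eval g)).

Let cos_bounded w := @frequency_signal_bounded R tk w _
  (@continuous_cos R) (@cos_max R).

Let sin_bounded w : essentially_bounded
  (fun t : time R tk => - sin (w * real_of_time t)) 1.
Proof.
apply: (@frequency_signal_bounded R tk w (fun x => - sin x)) => x.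
  by apply: cvgN; exact: continuous_sin.
by rewrite normrN sin_max.
Qed.

Lemma fourier_linear (w a : R) (g h : H) :
  fourier w (rkhs_eval (a *: g + h)) =
  a%:C * fourier w (rkhs_eval g) + fourier w (rkhs_eval h).
Proof.
rewrite !fourierE (rkhs_functional_linear _ _ _ (cos_bounded w)).
by rewrite (rkhs_functional_linear _ _ _ (sin_bounded w)); simpc.
Qed.

Lemma gainD w g h : gain w (g + h) <= gain w g + gain w h.
Proof.
rewrite /gain -[in leLHS](scale1r g) fourier_linear mul1r.
exact: le_normcD.
Qed.

Lemma gainZ w a g : gain w (a *: g) = `|a| * gain w g.
Proof.
rewrite /gain; have fourier0 : fourier w (rkhs_eval (0 : H)) = 0.
  have := fourier_linear w 1 0 0; rewrite scaler0 addr0 mul1r.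
  by move/eqP; rewrite -subr_eq subrr => /eqP.
rewrite -[a *: g]addr0 fourier_linear fourier0 addr0.
by rewrite ComplexField.Normc.normcM normc_real.
Qed.

(** The constant does not depend on the frequency, because [cos] and [sin] are
bounded by 1 at all frequencies. *)
Lemma gain_bounded : exists C : R, forall w g, gain w g <= C * `|g|.
Proof.
have [B BP] := rkhs_functional_bounded; exists (B + B) => w g.
rewrite /gain fourierE; apply: le_trans (normc_le_sum _ _) _.
rewrite mulrDl -[B]mul1r; apply: lerD; apply: BP => //; exact: sin_bounded.
Qed.

End time_functionals.

(** * The identification problem *)

Theorem corollary7 (R : realType) (tk : time_kind)
    (k : time R tk -> time R tk -> R) (H : rkhs k)
    (u : two_sided_time R tk -> R)
    (S : {fset time R tk}) (y : S -> R) (lambda rho : R) :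
  mercer_kernel k -> stable H -> (mu0 k < +oo)%E ->
  bounded_input u -> 0 < lambda -> 0 <= rho ->
  let J (g : H) : R :=
    \sum_(t : S) (output u (val t) (rkhs_eval g) - y t) ^+ 2
      + lambda * `|g| ^+ 2 in
  let bound : R := Num.sqrt (lambda^-1 * \sum_(t : S) y t ^+ 2) in
  let fourier_gain (w : R) (g : H) : R :=
    ComplexField.Normc.normc (fourier w (rkhs_eval g)) in
  let transfer_gain (w : R) (g : H) : R :=
    ComplexField.Normc.normc (transfer_function (rkhs_eval g) ('i%C * w%:C)) in
  let well_posed (gain : R -> H -> R) : Prop :=
    convex_problem J (frequencies R tk) gain rho /\
    exists g : H,
      [/\ is_solution J (frequencies R tk) gain rho g,
          forall h : H, is_solution J (frequencies R tk) gain rho h -> h = g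
        & `|g| <= bound] in
  well_posed fourier_gain /\ well_posed transfer_gain.
Proof.
move=> k_mercer H_stable mu0_fin u_bounded lambda0 rho0 J bound fourier_gain
  transfer_gain well_posed.
suff well : well_posed fourier_gain.
  split=> //; rewrite (_ : transfer_gain = fourier_gain)//.
  apply/funext => w; apply/funext => g.
  by rewrite /transfer_gain transfer_function_imaginary_axis.
have [B BP] := rkhs_functional_bounded k_mercer H_stable mu0_fin.
have /choice[M MP] : forall t : S, exists M : R,
    0 <= M /\ essentially_bounded (delayed u (val t)) M.
  by move=> t; have [M M0 uM] := delayed_essentially_bounded (val t) u_bounded;
    exists M.
have [C CP] := gain_bounded k_mercer H_stable mu0_fin.
apply: (@regularized_least_squares_well_posed R H _ (@rkhs_normE _ _ _ H) S
  (fun t g => output u (val t) (rkhs_eval g)) (fun t => M t * B) y _ _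
  R (frequencies R tk) fourier_gain C) => //.
- by move=> t a g h; exact: rkhs_functional_linear (MP t).2.
- by move=> t g; apply: BP; case: (MP t).
- by move=> w g h; exact: gainD.
- by move=> w a g; exact: gainZ.
Qed.
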